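(* Let $I$ be a proper ideal of a commutative ring $R$ such that $I = P_1 \cap \cdots \cap P_n$ for distinct (pairwise) comaximal prime ideals $P_1, \ldots, P_n$ of $R$. Then $I[X]$ is an sdf-absorbing ideal of $R[X]$ if and only if $I$ is an sdf-absorbing ideal of $R$.
   Context: All rings are commutative with identity $1 \neq 0$. A proper ideal $I$ of a commutative ring $R$ is a square-difference factor absorbing ideal (sdf-absorbing ideal) of $R$ if whenever $a, b \in R$ are both nonzero and $a^2 - b^2 \in I$, then $a + b \in I$ or $a - b \in I$. $I[X]$ denotes the ideal of $R[X]$ consisting of the polynomials with all coefficients in $I$. Here $n \geq 1$, and comaximal means $P_i + P_j = R$ for $i \neq j$. *)

(* Defs.v *)
From HB Require Import structures.
From mathcomp Require Import all_boot all_order all_algebra.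
From mathcomp Require Import mathcomp_extra boolp classical_sets.

Set Implicit Arguments.
Unset Strict Implicit.
Unset Printing Implicit Defensive.

Import GRing.Theory.

Local Open Scope classical_set_scope.
Local Open Scope ring_scope.

(* Ideals are arbitrary subsets [I : set R], not only decidable ones; [mem I] is
   the classical membership predicate of [I], to which the predicates of
   mathcomp's ring_quotient and poly apply. [idealr_closed] includes [1 \notin I]. *)
Definition is_proper_ideal (R : comNzRingType) (I : set R) : Prop :=
  idealr_closed (mem I).

Definition is_prime_ideal (R : comNzRingType) (P : set R) : Prop :=
  is_proper_ideal P /\ prime_idealr_closed (mem P).

Definition comaximal (R : comNzRingType) (I J : set R) : Prop :=
  [set x + y | x in I & y in J] = [set: R].

Definition ideal_poly (R : comNzRingType) (I : set R) : set {poly R} :=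
  [set p | p \is a polyOver (mem I)].

Definition sdf_absorbing (R : comNzRingType) (I : set R) : Prop :=
  is_proper_ideal I /\
  forall a b : R, a != 0 -> b != 0 ->
    a ^+ 2 - b ^+ 2 \in I -> a + b \in I \/ a - b \in I.

(* Main.v *)
Require Import Defs.
From HB Require Import structures.
From mathcomp Require Import all_boot all_order all_algebra.
From mathcomp Require Import mathcomp_extra boolp classical_sets.
From mathcomp Require Import ring.

(** Modulo a prime ideal [P], the relation [a ^+ 2 = b ^+ 2] means [a = b] or
    [a = - b]. When [2 \in P] the two alternatives coincide, and when
    [2 \notin P] they are really different. An intersection [I] of comaximal
    primes [P i] is therefore sdf-absorbing exactly when at most one [P i]
    omits [2]: then the sign is prescribed by that single prime, whereas two
    primes omitting [2] can be made to ask for opposite signs by the Chinese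
    remainder theorem. These two implications are
    [sdf_absorbing_bigcap_prime] and [bigcap_comaximal_sdf_absorbing].

    The condition on [2] only concerns constants, and the ideal [I[X]] is the
    intersection of the ideals [(P i)[X]], which are prime by Gauss's argument
    ([ideal_poly_prime]), so the condition passes from [I] to [I[X]]. The
    converse is restriction to constant polynomials. *)

Set Implicit Arguments.
Unset Strict Implicit.

Local Open Scope classical_set_scope.
Local Open Scope ring_scope.
Import GRing.Theory.

Section Ideals.
Context {R : comNzRingType}.
Implicit Types I P Q : set R.

Lemma ideal0 I : is_proper_ideal I -> 0 \in I.
Proof. by case. Qed.

Lemma ideal1 I : is_proper_ideal I -> 1 \notin I.
Proof. by case. Qed.

Lemma idealD I x y : is_proper_ideal I -> x \in I -> y \in I -> x + y \in I.
Proof. by case=> _ _ cI xI yI; rewrite -[x]mul1r; apply: cI. Qed.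

Lemma idealMl I a x : is_proper_ideal I -> x \in I -> a * x \in I.
Proof.
by move=> [h0 _ cI] xI; rewrite -[a * x]addr0; apply: cI.
Qed.

Lemma idealMr I a x : is_proper_ideal I -> x \in I -> x * a \in I.
Proof. by move=> hI xI; rewrite mulrC; apply: idealMl. Qed.

Lemma idealB I x y : is_proper_ideal I -> x \in I -> y \in I -> x - y \in I.
Proof.
move=> hI xI yI; rewrite -mulN1r.
by apply: idealD => //; apply: idealMl.
Qed.

Lemma ideal_sum I (T : Type) (r : seq T) (p : pred T) (F : T -> R) :
  is_proper_ideal I -> (forall i, p i -> F i \in I) ->
  (\sum_(i <- r | p i) F i) \in I.
Proof.
move=> hI FI; apply: (big_ind (fun x => x \in I)) => //; first exact: ideal0.
by move=> x y; apply: idealD.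
Qed.

Lemma primeM P x y : is_prime_ideal P -> x * y \in P -> x \in P \/ y \in P.
Proof. by case=> _ pP xyP; apply/orP/pP. Qed.

Lemma in_bigcap (T : Type) (P : T -> set R) x :
  x \in \bigcap_(i in [set: T]) P i <-> forall i, x \in P i.
Proof.
split=> [|h]; first by move=> /set_mem h i; apply/mem_set/h.
by apply/mem_set => i _; apply/set_mem/h.
Qed.

(** One half of the Chinese remainder theorem: if [P j] is comaximal to each
    other member of a finite family then it is comaximal to their intersection.
    Writing [1 = x k + y k] with [x k \in P j] and [y k \in P k], the product
    of the [y k] is congruent to [1] modulo [P j]. *)
Lemma comaximal_separate (T : finType) (P : T -> set R) (j : T) :
    (forall k, is_proper_ideal (P k)) ->
    (forall k, k != j -> comaximal (P j) (P k)) ->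
  exists y, 1 - y \in P j /\ forall k, k != j -> y \in P k.
Proof.
move=> hP hco.
have split1 k : exists y, k != j -> 1 - y \in P j /\ y \in P k.
  have [->|kj] := eqVneq k j; first by exists 0.
  have : [set: R] 1 by [].
  rewrite -(hco k kj) => -[x xj [y yk xy]]; exists y => _; split.
    by rewrite -xy addrK; apply/mem_set.
  exact/mem_set.
have [y hy] := choice split1.
exists (\prod_(k | k != j) y k); split.
  apply: (big_ind (fun z => 1 - z \in P j)).
  - by rewrite subrr; apply: ideal0.
  - move=> a b aj bj.
    rewrite [1 - a * b](_ : _ = (1 - a) + a * (1 - b)); last by ring.
    by apply: idealD => //; apply: idealMl.
  - by move=> k /hy[].
move=> k kj; rewrite (bigD1 k) //=; apply: idealMr => //.
by have [] := hy k kj.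
Qed.

(** If [a + b] fails to lie in the intersection, some [P k] contains [a - b]
    but not [a + b]; so [2 \notin P k], hence [2] lies in every other [P i] and
    [a - b], [a + b] are congruent there. *)
Lemma sdf_absorbing_bigcap_prime (T : eqType) (P : T -> set R) :
    is_proper_ideal (\bigcap_(i in [set: T]) P i) ->
    (forall i, is_prime_ideal (P i)) ->
    (forall i j, i != j -> 2%:R \in P i \/ 2%:R \in P j) ->
  sdf_absorbing (\bigcap_(i in [set: T]) P i).
Proof.
move=> hI hP h2; split=> // a b _ _ /in_bigcap hab.
have {hab} abP i : a + b \in P i \/ a - b \in P i.
  by apply: primeM => //; rewrite mulrC -subr_sqr.
have [abI|/existsNP[k abk]] := pselect (forall i, a + b \in P i).
  by left; apply/in_bigcap.
right; apply/in_bigcap => i; have [abi|//] := abP i.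
have ik : i != k by apply/eqP => eik; apply: abk; rewrite -eik.
have [pi pk] := ((hP i).1, (hP k).1).
have [i2|k2] := h2 _ _ ik.
  rewrite [a - b](_ : _ = (a + b) - b * 2%:R); last by ring.
  by apply: idealB => //; apply: idealMl.
case: abk; have [//|abk] := abP k.
rewrite [a + b](_ : _ = (a - b) + b * 2%:R); last by ring.
by apply: idealD => //; apply: idealMl.
Qed.

(** With [y] separating [P j] from the other primes, [1 - 2y] is [-1] modulo
    [P j] and [1] modulo all the others, so its square is [1] modulo the
    intersection. Absorption forces [2 \in P i] or [2 \in P j]. *)
Lemma bigcap_comaximal_sdf_absorbing (T : finType) (P : T -> set R) :
    (forall i, is_prime_ideal (P i)) ->
    (forall i j, i != j -> comaximal (P i) (P j)) ->
    sdf_absorbing (\bigcap_(i in [set: T]) P i) ->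
  forall i j, i != j -> 2%:R \in P i \/ 2%:R \in P j.
Proof.
move=> hP hco [_ sdf] i j ij.
have pP k : is_proper_ideal (P k) := (hP k).1.
have [|y [yj yP]] := @comaximal_separate _ P j pP.
  by move=> k kj; apply: hco; rewrite eq_sym.
have not1 k z : z \in P k -> 1 - z \notin P k.
  move=> zk; apply/negP => /(idealD (pP k))/(_ zk).
  by rewrite subrK; apply/negP/ideal1.
have b0 : 1 - 2%:R * y != 0.
  apply: contra (not1 i (2%:R * y) _); last by apply: idealMl => //; apply: yP.
  by move=> /eqP->; apply: ideal0.
have [|/in_bigcap/(_ i)|/in_bigcap/(_ j)] := sdf 1 _ (oner_neq0 R) b0.
- apply/in_bigcap => k.
  rewrite [X in X \in _](_ : _ = 4%:R * y * (1 - y)); last by ring.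
  have [->|kj] := eqVneq k j; first exact: idealMl.
  by apply: idealMr => //; apply: idealMl => //; apply: yP.
- rewrite [X in X \in _](_ : _ = 2%:R * (1 - y)); last by ring.
  case/(primeM (hP i)) => [|yi]; first by left.
  by have /negP := not1 i y (yP i ij).
- rewrite [X in X \in _](_ : _ = 2%:R * y); last by ring.
  case/(primeM (hP j)) => [|yj']; first by right.
  by have /negP := not1 j y yj'.
Qed.

End Ideals.

Section PolynomialIdeals.
Context {R : comNzRingType}.
Implicit Types I P : set R.

Lemma in_ideal_poly I (p : {poly R}) :
  is_proper_ideal I -> p \in ideal_poly I <-> forall i, p`_i \in I.
Proof.
move=> hI; split=> [/set_mem/(all_nthP 0) pI i|pI].
  have [/pI //|/(nth_default 0)->] := ltnP i (size p); exact: ideal0.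
by apply/mem_set/(all_nthP 0) => i _; apply: pI.
Qed.

Lemma ideal_polyC I c :
  is_proper_ideal I -> (c%:P \in ideal_poly I) = (c \in I).
Proof.
move=> hI; apply/idP/idP => [/(in_ideal_poly _ hI)/(_ 0)|cI].
  by rewrite coefC.
by apply/(in_ideal_poly _ hI) => -[|i]; rewrite coefC //=; apply: ideal0.
Qed.

Lemma ideal_poly_proper I : is_proper_ideal I -> is_proper_ideal (ideal_poly I).
Proof.
move=> hI; split.
- by change (0 \in ideal_poly I); rewrite -polyC0 ideal_polyC //; apply: ideal0.
- change (1 \notin ideal_poly I); rewrite -polyC1 ideal_polyC //; exact: ideal1.
- move=> p q r /(in_ideal_poly _ hI) qI /(in_ideal_poly _ hI) rI.
  apply/(in_ideal_poly _ hI) => i.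
  rewrite coefD coefM; apply: idealD => //.
  by apply: ideal_sum => // k _; apply: idealMl.
Qed.

(** Gauss's argument: if [m] and [n] are the first indices where [p] and [q]
    have a coefficient outside [P], then in the coefficient of [p * q] of index
    [m + n] every term but [p`_m * q`_n] lies in [P]. *)
Lemma ideal_poly_prime P : is_prime_ideal P -> is_prime_ideal (ideal_poly P).
Proof.
move=> hP; have pP := hP.1; split; first exact: ideal_poly_proper.
move=> p q /(in_ideal_poly _ pP) pqP; apply/orP.
have first_out (r : {poly R}) : r \in ideal_poly P \/
    exists m, r`_m \notin P /\ forall k, (k < m)%N -> r`_k \in P.
  have [rP|/existsNP[k /negP rk]] := pselect (forall i, r`_i \in P).
    by left; apply/(in_ideal_poly _ pP).
  right; have ex : exists k, r`_k \notin P by exists k.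
  case: (ex_minnP ex) => m rm min; exists m; split=> // l lm.
  by apply: contraT => /min; rewrite leqNgt lm.
have [|[m [pm pmin]]] := first_out p; first by left.
have [|[n [qn qmin]]] := first_out q; first by right.
have mlt : (m < (m + n).+1)%N by rewrite ltnS leq_addr.
have := pqP (m + n)%N; rewrite coefM (bigD1 (Ordinal mlt)) //= addKn => sumP.
suff /(idealB pP sumP) : (\sum_(k < (m + n).+1 | k != Ordinal mlt)
    p`_k * q`_(m + n - k)) \in P.
  by rewrite addrK => /(primeM hP)[] h; [case/negP: pm|case/negP: qn].
apply: ideal_sum => // k; rewrite -val_eqE /= neq_ltn => /orP[km|mk].
  by apply: idealMr => //; apply: pmin.
apply: idealMl => //; apply: qmin.
by rewrite ltn_subLR ?ltn_add2r // -ltnS.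
Qed.

Lemma ideal_poly_bigcap (T : Type) (P : T -> set R) :
  ideal_poly (\bigcap_(i in [set: T]) P i) =
  \bigcap_(i in [set: T]) ideal_poly (P i).
Proof.
apply/seteqP; split=> p.
  move=> /(all_nthP 0) pP i _; apply/(all_nthP 0) => k /pP.
  by move=> /in_bigcap; apply.
move=> pP; apply/(all_nthP 0) => k kp; apply/in_bigcap => i.
by have /(all_nthP 0) := pP i I; apply.
Qed.

Lemma sdf_absorbing_ideal_poly I :
  is_proper_ideal I -> sdf_absorbing (ideal_poly I) -> sdf_absorbing I.
Proof.
move=> hI [_ sdf]; split=> // a b a0 b0 abI.
have := sdf a%:P b%:P; rewrite !polyC_eq0 -!polyC_exp -polyCB -polyCD -polyCB.
by rewrite !ideal_polyC //; apply.
Qed.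

End PolynomialIdeals.

Theorem theorem4p5 (R : comNzRingType) (I : set R) (n : nat) (P : 'I_n -> set R)
    (hn : (0 < n)%N)
    (hI : is_proper_ideal I)
    (hP : forall i, is_prime_ideal (P i))
    (hdist : injective P)
    (hcomax : forall i j, i != j -> comaximal (P i) (P j))
    (hcap : I = \bigcap_(i in [set: 'I_n]) P i) :
  sdf_absorbing (ideal_poly I) <-> sdf_absorbing I.
Proof.
split; first exact: sdf_absorbing_ideal_poly.
move=> sdfI; have hIX := ideal_poly_proper hI.
rewrite hcap ideal_poly_bigcap in sdfI hIX *.
apply: sdf_absorbing_bigcap_prime => // [i|i j ij].
  exact: ideal_poly_prime.
have [pi pj] := ((hP i).1, (hP j).1).
rewrite -!polyC_natr !ideal_polyC //.
exact: bigcap_comaximal_sdf_absorbing ij.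
Qed.
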